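(* Let $w=(w(n))_{n\in\mathbb{N}}$ be a bounded, strictly positive sequence such that $w\in\ell_1$ and $\mathsf{C}^{(1,w)}\in\mathcal{L}(\ell_1(w))$. The following conditions are equivalent. (i) The range of $I-\mathsf{C}^{(1,w)}$ is closed in $\ell_1(w)$. (ii) $(I-\mathsf{C}^{(1,w)})(\ell_1(w))=X_1(w)$. (iii) $(I-\mathsf{C}^{(1,w)})(X_1(w))=X_1(w)$. (iv) $\mathcal{U}_w:=\sup_{m\in\mathbb{N}}\frac{1}{m\,w(m+1)}\sum_{n=m+1}^\infty w(n)<\infty$.
   Context: The discrete Cesàro operator $\mathsf{C}\colon\mathbb{C}^{\mathbb{N}}\to\mathbb{C}^{\mathbb{N}}$ is the linear map $\mathsf{C}x:=\left(\frac{x_1+\dots+x_n}{n}\right)_{n\in\mathbb{N}}$ for $x=(x_n)_{n\in\mathbb{N}}$, with $\mathbb{N}=\{1,2,\dots\}$. For a bounded, strictly positive sequence $w$, $\ell_1(w):=\{x\in\mathbb{C}^{\mathbb{N}}\colon \sum_{n=1}^\infty w(n)|x_n|<\infty\}$, a Banach space for the norm $\|x\|_{1,w}:=\sum_{n=1}^\infty w(n)|x_n|$, and $X_1(w):=\{x\in\ell_1(w)\colon x_1=0\}$. $\mathcal{L}(X)$ is the space of continuous linear operators on a Banach space $X$; $I$ is the identity. Writing $\mathsf{C}^{(1,w)}\in\mathcal{L}(\ell_1(w))$ means that $\mathsf{C}$ maps $\ell_1(w)$ continuously into itself, and $\mathsf{C}^{(1,w)}$ denotes the restriction of $\mathsf{C}$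 to $\ell_1(w)$. *)

(* Defs.v *)
From Stdlib Require Import Reals Lra FunctionalExtensionality ProofIrrelevance.
From Coquelicot Require Export Coquelicot.
Open Scope R_scope.

(** Sequences are indexed by [nat] starting at 0: the entry at index [n] is the
    entry of index [n + 1] of the mathematical sequence, whose indices start
    at 1. *)

Record weight := Weight {
  weight_fun :> nat -> R;
  weight_bounded : exists M : R, forall n, Rabs (weight_fun n) <= M;
  weight_pos : forall n, 0 < weight_fun n
}.

Definition cesaro (x : nat -> C) : nat -> C :=
  fun n => (sum_n x n / RtoC (INR (S n)))%C.

Definition in_l1 (w : weight) (x : nat -> C) : Prop :=
  ex_series (fun n => w n * Cmod (x n)).

Record l1 (w : weight) := L1 {
  l1_seq :> nat -> C;
  l1_prop : in_l1 w l1_seq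
}.
Arguments L1 {w} _ _.
Arguments l1_seq {w} _ _.
Arguments l1_prop {w} _.

Lemma l1_ext (w : weight) (x y : l1 w) : (forall n, x n = y n) -> x = y.
Proof.
destruct x as [x Hx], y as [y Hy]; simpl; intros H.
assert (E : x = y) by (apply functional_extensionality; exact H).
subst y; f_equal; apply proof_irrelevance.
Qed.

Lemma l1_term_ge0 (w : weight) (x : nat -> C) n : 0 <= w n * Cmod (x n).
Proof.
apply Rmult_le_pos; [apply Rlt_le, weight_pos | apply Cmod_ge_0].
Qed.

Lemma l1_term_plus (w : weight) (x y : nat -> C) n :
  w n * Cmod (x n + y n)%C <= w n * Cmod (x n) + w n * Cmod (y n).
Proof.
rewrite <- Rmult_plus_distr_l.
apply Rmult_le_compat_l; [apply Rlt_le, weight_pos | apply Cmod_triangle].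
Qed.

Lemma in_l1_plus (w : weight) (x y : nat -> C) :
  in_l1 w x -> in_l1 w y -> in_l1 w (fun n => x n + y n)%C.
Proof.
intros Hx Hy.
apply (ex_series_le (K := R_AbsRing) (V := R_CompleteNormedModule) _
         (fun n => w n * Cmod (x n) + w n * Cmod (y n))).
- intros n; change (Rabs (w n * Cmod (x n + y n)%C)
                    <= w n * Cmod (x n) + w n * Cmod (y n)).
  rewrite Rabs_pos_eq; [apply l1_term_plus|].
  apply (l1_term_ge0 w (fun n => x n + y n)%C).
- exact (ex_series_plus _ _ Hx Hy).
Qed.

Lemma in_l1_scal (w : weight) (a : C) (x : nat -> C) :
  in_l1 w x -> in_l1 w (fun n => a * x n)%C.
Proof.
intros Hx.
apply (ex_series_ext (fun n => Cmod a * (w n * Cmod (x n)))).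
- intros n; rewrite Cmod_mult.
  change (Cmod a * (w n * Cmod (x n)) = w n * (Cmod a * Cmod (x n))); ring.
- exact (ex_series_scal (V := R_NormedModule) (Cmod a) _ Hx).
Qed.

Lemma in_l1_opp (w : weight) (x : nat -> C) :
  in_l1 w x -> in_l1 w (fun n => - x n)%C.
Proof.
intros Hx; apply (ex_series_ext (fun n => w n * Cmod (x n))); [|exact Hx].
intros n; rewrite Cmod_opp; reflexivity.
Qed.

Lemma in_l1_zero (w : weight) : in_l1 w (fun _ => RtoC 0).
Proof.
apply (ex_series_ext (fun n => 0 * (w n * 0))).
- intros n; rewrite Cmod_0; change (0 * (w n * 0) = w n * 0); ring.
- exists 0; apply (is_series_ext (fun _ : nat => 0)).
  + intros n; change (0 = 0 * (w n * 0)); ring.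
  + apply (filterlim_ext (fun _ : nat => 0)); [|apply filterlim_const].
    intros n; rewrite sum_n_const; ring.
Qed.

Definition l1_plus {w} (x y : l1 w) : l1 w :=
  L1 _ (in_l1_plus w x y (l1_prop x) (l1_prop y)).
Definition l1_opp {w} (x : l1 w) : l1 w := L1 _ (in_l1_opp w x (l1_prop x)).
Definition l1_zero {w} : l1 w := L1 _ (in_l1_zero w).
Definition l1_scal {w} (a : C) (x : l1 w) : l1 w :=
  L1 _ (in_l1_scal w a x (l1_prop x)).

Definition l1_norm {w} (x : l1 w) : R := Series (fun n => w n * Cmod (x n)).

Definition l1_AbelianMonoid_mixin (w : weight) : AbelianMonoid.mixin_of (l1 w).
Proof.
apply (AbelianMonoid.Mixin (l1 w) l1_plus l1_zero);
  intros; apply l1_ext; intros; simpl; ring.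
Defined.

Canonical l1_AbelianMonoid (w : weight) :=
  AbelianMonoid.Pack (l1 w) (l1_AbelianMonoid_mixin w) (l1 w).

Definition l1_AbelianGroup_mixin (w : weight) :
  AbelianGroup.mixin_of (l1_AbelianMonoid w).
Proof.
apply (AbelianGroup.Mixin (l1_AbelianMonoid w) l1_opp).
intros x; apply l1_ext; intros n; simpl; ring.
Defined.

Canonical l1_AbelianGroup (w : weight) :=
  AbelianGroup.Pack (l1 w)
    (AbelianGroup.Class _ (l1_AbelianMonoid_mixin w) (l1_AbelianGroup_mixin w))
    (l1 w).

Definition l1_ModuleSpace_mixin (w : weight) :
  ModuleSpace.mixin_of C_Ring (l1_AbelianGroup w).
Proof.
apply (ModuleSpace.Mixin C_Ring (l1_AbelianGroup w) l1_scal);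
  intros; apply l1_ext; intros; simpl;
  unfold mult, plus, one; simpl; ring.
Defined.

Definition l1_ModuleSpace_class (w : weight) :
  ModuleSpace.class_of C_Ring (l1 w) :=
  ModuleSpace.Class C_Ring (l1 w)
    (AbelianGroup.Class _ (l1_AbelianMonoid_mixin w) (l1_AbelianGroup_mixin w))
    (l1_ModuleSpace_mixin w).

Canonical l1_ModuleSpace (w : weight) :=
  ModuleSpace.Pack C_Ring (l1 w) (l1_ModuleSpace_class w) (l1 w).

Lemma l1_norm_triangle (w : weight) (x y : l1 w) :
  l1_norm (plus x y) <= l1_norm x + l1_norm y.
Proof.
unfold l1_norm.
rewrite <- (Series_plus _ _ (l1_prop x) (l1_prop y)).
apply Series_le.
- intros n; split; [apply l1_term_ge0 | apply l1_term_plus].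
- exact (ex_series_plus _ _ (l1_prop x) (l1_prop y)).
Qed.

Lemma l1_norm_scal (w : weight) (a : C) (x : l1 w) :
  l1_norm (l1_scal a x) = Cmod a * l1_norm x.
Proof.
unfold l1_norm; rewrite <- Series_scal_l.
apply Series_ext; intros n; simpl; rewrite Cmod_mult; ring.
Qed.

Lemma l1_norm_minus_sym (w : weight) (x y : l1 w) :
  l1_norm (minus x y) = l1_norm (minus y x).
Proof.
apply Series_ext; intros n; simpl; rewrite <- Cmod_opp.
do 2 f_equal; ring.
Qed.

Lemma l1_norm_zero (w : weight) : l1_norm (zero : l1 w) = 0.
Proof.
unfold l1_norm.
rewrite (Series_ext _ (fun n => 0 * (w n * 0))).
- rewrite Series_scal_l; ring.
- intros n; simpl; rewrite Cmod_0; ring.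
Qed.

Lemma l1_norm_eq_zero (w : weight) (x : l1 w) : l1_norm x = 0 -> x = zero.
Proof.
intros H; apply l1_ext; intros n; simpl; apply Cmod_eq_0.
set (u := fun n => w n * Cmod (x n)).
assert (Hu : is_series u 0)
  by (rewrite <- H; apply Series_correct, (l1_prop x)).
assert (Hu0 : forall m, 0 <= u m) by (intros m; apply l1_term_ge0).
assert (HS : forall m, sum_n u (S m) = sum_n u m + u (S m))
  by (intros m; apply (sum_Sn u m)).
assert (H0 : sum_n u 0 = u 0%nat) by apply (sum_O u).
assert (Hle : sum_n u n <= 0).
{ apply (is_lim_seq_incr_compare (sum_n u) 0 Hu).
  intros m; rewrite HS; specialize (Hu0 (S m)); lra. }
assert (P : forall m, 0 <= sum_n u m).
{ intros m; induction m as [|m IH].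
  - rewrite H0; apply Hu0.
  - rewrite HS; specialize (Hu0 (S m)); lra. }
assert (Hn : u n <= 0).
{ destruct n as [|n]; [lra|].
  rewrite HS in Hle; specialize (P n); lra. }
unfold u in Hn.
assert (Q := weight_pos w n); assert (Q' := Cmod_ge_0 (x n)); nra.
Qed.

Definition l1_ball {w} (x : l1 w) (eps : R) (y : l1 w) : Prop :=
  l1_norm (minus y x) < eps.

Definition l1_UniformSpace_mixin (w : weight) : UniformSpace.mixin_of (l1 w).
Proof.
apply (UniformSpace.Mixin (l1 w) l1_zero l1_ball); unfold l1_ball.
- intros x e; rewrite minus_eq_zero, l1_norm_zero; apply cond_pos.
- intros x y e; rewrite l1_norm_minus_sym; trivial.
- intros x y z e1 e2 H1 H2.
  rewrite (minus_trans y z x).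
  apply Rle_lt_trans with (1 := l1_norm_triangle _ _ _); lra.
Defined.

Canonical l1_UniformSpace (w : weight) :=
  UniformSpace.Pack (l1 w) (l1_UniformSpace_mixin w) (l1 w).

Definition l1_NormedModuleAux_class (w : weight) :
  NormedModuleAux.class_of C_AbsRing (l1 w) :=
  NormedModuleAux.Class C_AbsRing (l1 w)
    (l1_ModuleSpace_class w) (l1_UniformSpace_mixin w).

Canonical l1_NormedModuleAux (w : weight) :=
  NormedModuleAux.Pack C_AbsRing (l1 w) (l1_NormedModuleAux_class w) (l1 w).

Definition l1_NormedModule_mixin (w : weight) :
  NormedModule.mixin_of C_AbsRing (l1_NormedModuleAux w).
Proof.
apply (NormedModule.Mixin C_AbsRing (l1_NormedModuleAux w) l1_norm 1).
- apply l1_norm_triangle.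
- intros a x; apply Req_le; exact (l1_norm_scal w a x).
- intros x y eps H; exact H.
- intros x y eps H; rewrite Rmult_1_l; exact H.
- apply l1_norm_eq_zero.
Defined.

Canonical l1_NormedModule (w : weight) :=
  NormedModule.Pack C_AbsRing (l1 w)
    (NormedModule.Class C_AbsRing (l1 w)
       (l1_NormedModuleAux_class w) (l1_NormedModule_mixin w))
    (l1 w).

Definition X1 {w : weight} (x : l1 w) : Prop := x 0%nat = RtoC 0.

(** [T] is the restriction of the Cesàro operator to [l1 w], and it is a
    continuous linear operator on [l1 w]; the existence of such a [T] includes
    the fact that the Cesàro operator maps [l1 w] into itself. Coquelicot's
    [is_linear] includes the boundedness of the operator. *)
Definition is_cesaro_l1 {w : weight} (T : l1 w -> l1 w) : Prop :=
  (forall (x : l1 w) (n : nat), T x n = cesaro x n) /\ is_linear T.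

Definition I_minus {w : weight} (T : l1 w -> l1 w) (x : l1 w) : l1 w :=
  minus x (T x).

Definition image {U V : Type} (f : U -> V) (D : U -> Prop) (y : V) : Prop :=
  exists x : U, D x /\ f x = y.

Definition range {U V : Type} (f : U -> V) : V -> Prop :=
  image f (fun _ => True).

(** With indices starting at 0, the supremum over [m >= 1] is over [m = k + 1],
    and both [w(m+1)] and the first term of the tail are [w (S k)]. *)
Definition U_ (w : weight) : Rbar :=
  Sup_seq (fun k : nat =>
    Finite (/ (INR (S k) * w (S k)) * Series (fun j => w (S k + j)%nat))).

(* Main.v *)
(** Writing [y = (I - C) x] in terms of the means [C x], one finds that for
    [x_1 = 0] the equation forces [(C x)_n = y_2/1 + ... + y_n/(n-1)], so
    [x = y + Z] with [Z_n] this sum; hence [y] in [X1] has a preimage iff [Z]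
    lies in [l1 w].  Constants belong to [l1 w] and are killed by [I - C], so
    [I - C] and its restriction to [X1] have the same range.  For finitely
    supported [y] the sequence [Z] is eventually constant, so the range is
    always dense in [X1].  Summation by parts gives
    [sum w_n |Z_n| <= sum |y_n| W_n / (n-1)], with [W] the tails of [w] and
    equality for [y >= 0]; surjectivity onto [X1] is therefore the boundedness
    of the multipliers [W_n / ((n-1) w_n)] of [l1]. *)

Require Import Defs.
From Stdlib Require Import Reals Arith Lra Lia Classical.
From Coquelicot Require Import Coquelicot.
Open Scope R_scope.

(** * Finite sums and series with nonnegative terms *)

Lemma sum_n_S_R (u : nat -> R) n : sum_n u (S n) = sum_n u n + u (S n) :> R.
Proof. apply (sum_Sn u n). Qed.

Lemma sum_n_S_C (u : nat -> C) n : sum_n u (S n) = (sum_n u n + u (S n))%C :> C.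
Proof. apply (sum_Sn u n). Qed.

Lemma sum_n_nonneg (u : nat -> R) n :
  (forall k, 0 <= u k) -> 0 <= sum_n u n.
Proof.
intros Hu; induction n as [|n IH].
- rewrite sum_O; apply Hu.
- rewrite sum_n_S_R; specialize (Hu (S n)); lra.
Qed.

Lemma ex_series_pos_bounded (u : nat -> R) (M : R) :
  (forall n, 0 <= u n) -> (forall n, sum_n u n <= M) -> ex_series u.
Proof.
intros Hu HM.
destruct (ex_finite_lim_seq_incr (sum_n u) M) as [l Hl].
- intros n; rewrite sum_n_S_R; specialize (Hu (S n)); lra.
- exact HM.
- exists l; exact Hl.
Qed.

Lemma sum_n_le_Series (u : nat -> R) n :
  (forall k, 0 <= u k) -> ex_series u -> sum_n u n <= Series u.
Proof.
intros Hu Eu.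
apply (is_lim_seq_incr_compare (sum_n u)).
- exact (Series_correct _ Eu).
- intros k; rewrite sum_n_S_R; specialize (Hu (S k)); lra.
Qed.

Lemma Cmod_sum_n (u : nat -> C) n :
  Cmod (sum_n u n) <= sum_n (fun k => Cmod (u k)) n.
Proof.
induction n as [|n IH].
- rewrite !sum_O; apply Rle_refl.
- rewrite sum_n_S_R, sum_n_S_C.
  eapply Rle_trans; [apply Cmod_triangle|]; lra.
Qed.

Lemma sum_n_RtoC (u : nat -> R) n :
  sum_n (fun k => RtoC (u k)) n = RtoC (sum_n u n).
Proof.
induction n as [|n IH].
- rewrite !sum_O; reflexivity.
- rewrite sum_n_S_R, sum_n_S_C, IH, RtoC_plus; reflexivity.
Qed.

(** * Tails of series and summation by parts *)

Definition tail (w : nat -> R) (n : nat) : R := Series (fun j => w (n + j)%nat).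

Lemma Series_split (u : nat -> R) n :
  ex_series u -> Series u = sum_n u n + tail u (S n).
Proof.
intros Eu; rewrite (Series_incr_n u (S n)); [|lia|exact Eu].
simpl pred; rewrite sum_n_Reals; reflexivity.
Qed.

Lemma tail_S (w : nat -> R) n : ex_series w -> tail w n = w n + tail w (S n).
Proof.
intros Ew; unfold tail; rewrite Series_incr_1.
- rewrite Nat.add_0_r; f_equal.
  apply Series_ext; intros j; f_equal; lia.
- exact (proj1 (ex_series_incr_n w n) Ew).
Qed.

Lemma tail_nonneg (w : nat -> R) n :
  ex_series w -> (forall k, 0 <= w k) -> 0 <= tail w n.
Proof.
intros Ew Hw; unfold tail.
eapply Rle_trans; [|apply (sum_n_le_Series _ 0)].
- rewrite sum_O; apply Hw.
- intros; apply Hw.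
- exact (proj1 (ex_series_incr_n w n) Ew).
Qed.

Lemma tail_small (u : nat -> R) (eps : R) :
  ex_series u -> 0 < eps -> exists n, tail u (S n) < eps.
Proof.
intros Eu Heps.
destruct (proj2 (is_lim_seq_spec (sum_n u) (Series u)) (Series_correct u Eu)
            (mkposreal eps Heps)) as [n Hn].
exists n; specialize (Hn n (le_n n)); simpl in Hn.
rewrite (Series_split u n Eu) in Hn.
apply Rabs_def2 in Hn; lra.
Qed.

Lemma summation_by_parts (w t : nat -> R) n :
  ex_series w ->
  sum_n (fun k => w k * sum_n t k) n
  = sum_n (fun k => t k * tail w k) n - tail w (S n) * sum_n t n :> R.
Proof.
intros Ew; induction n as [|n IH].
- rewrite !sum_O, (tail_S w 0 Ew); ring.
- rewrite !(sum_n_S_R (fun k => _ k * _ k)), IH, (sum_n_S_R t n), (tail_S w (S n) Ew); ring.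
Qed.

Lemma sum_n_weighted_le (w t : nat -> R) n :
  ex_series w -> (forall k, 0 <= w k) -> (forall k, 0 <= t k) ->
  sum_n (fun k => w k * sum_n t k) n <= sum_n (fun k => t k * tail w k) n.
Proof.
intros Ew Hw Ht; rewrite summation_by_parts by exact Ew.
assert (H1 := tail_nonneg w (S n) Ew Hw); assert (H2 := sum_n_nonneg t n Ht); nra.
Qed.

(** The boundary term [tail w (S n) * sum_n t n] left by summation by parts fits into the tail of
    the series on the right, because the partial sums of [t] increase. *)
Lemma sum_n_tail_le_Series (w t : nat -> R) n :
  ex_series w -> (forall k, 0 <= w k) -> (forall k, 0 <= t k) ->
  ex_series (fun k => w k * sum_n t k) ->
  sum_n (fun k => t k * tail w k) n <= Series (fun k => w k * sum_n t k).
Proof.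
intros Ew Hw Ht EZ.
assert (Hmono : forall j, sum_n t n <= sum_n t (S n + j)).
{ intros j; induction j as [|j IH].
  - rewrite Nat.add_0_r, sum_n_S_R; specialize (Ht (S n)); lra.
  - rewrite Nat.add_succ_r, sum_n_S_R; specialize (Ht (S (S n + j))); lra. }
rewrite (Series_split _ n EZ), summation_by_parts by exact Ew.
cut (tail w (S n) * sum_n t n <= tail (fun k => w k * sum_n t k) (S n)); [lra|].
unfold tail; rewrite <- Series_scal_r.
apply Series_le.
- intros j; split.
  + apply Rmult_le_pos; [apply Hw | apply sum_n_nonneg, Ht].
  + apply Rmult_le_compat_l; [apply Hw | apply Hmono].
- exact (proj1 (ex_series_incr_n _ (S n)) EZ).
Qed.

(** * Boundedness of multipliers of summable sequences *)

Fixpoint running_max (a : nat -> R) (n : nat) : R :=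
  match n with
  | O => 1
  | S n => Rmax (running_max a n) (a n)
  end.

Lemma running_max_ge1 (a : nat -> R) n : 1 <= running_max a n.
Proof.
induction n as [|n IH]; simpl; [lra|].
eapply Rle_trans; [exact IH | apply Rmax_l].
Qed.

(* With [u n] the square root of the running maximum, the telescoping sequence
   [/ u n - / u (S n)] is summable, vanishes unless [a n] sets a new record, and
   [a n * (/ u n - / u (S n)) >= u (S n) - u n]; so the bound on the sums of
   [a n * c n] bounds the records. *)
Lemma bounded_of_l1_multiplier (a : nat -> R) :
  (forall c : nat -> R, (forall n, 0 <= c n) -> ex_series c ->
     exists M, forall n, sum_n (fun k => a k * c k) n <= M) ->
  exists M, forall n, a n <= M.
Proof.
intros H.
set (u := fun n => sqrt (running_max a n)).
assert (Hu1 : forall n, 1 <= u n).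
{ intros n; rewrite <- sqrt_1; apply sqrt_le_1_alt, running_max_ge1. }
assert (Huu : forall n, u n * u n = running_max a n).
{ intros n; apply sqrt_sqrt; assert (Q := running_max_ge1 a n); lra. }
assert (Hincr : forall n, u n <= u (S n)).
{ intros n; apply sqrt_le_1_alt; simpl; apply Rmax_l. }
set (c := fun n => / u n - / u (S n)).
assert (Hc : forall n, 0 <= c n).
{ intros n; unfold c.
  cut (/ u (S n) <= / u n); [lra|].
  apply Rinv_le_contravar; [specialize (Hu1 n); lra | apply Hincr]. }
assert (Hsum : forall n, sum_n c n = / u O - / u (S n) :> R).
{ intros n; induction n as [|n IH]; [apply sum_O|].
  rewrite sum_n_S_R, IH; unfold c; ring. }
assert (Ec : ex_series c).
{ apply (ex_series_pos_bounded c (/ u O)); [exact Hc|].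
  intros n; rewrite Hsum.
  assert (0 < / u (S n)) by (apply Rinv_0_lt_compat; specialize (Hu1 (S n)); lra).
  lra. }
assert (Hrec : forall n, u (S n) - u n <= a n * c n).
{ intros n.
  assert (P1 := Hu1 n); assert (P2 := Hu1 (S n)); assert (P3 := Hincr n).
  assert (Hmax := Huu (S n)); simpl in Hmax.
  unfold Rmax in Hmax; destruct (Rle_dec (running_max a n) (a n)) as [Hle|Hgt].
  - rewrite <- Hmax; unfold c.
    replace (u (S n) * u (S n) * (/ u n - / u (S n)))
      with ((u (S n) - u n) * (u (S n) / u n)) by (field; lra).
    rewrite <- (Rmult_1_r (u (S n) - u n)) at 1.
    apply Rmult_le_compat_l; [lra|].
    apply (Rmult_le_reg_r (u n)); [lra|].
    unfold Rdiv; rewrite Rmult_assoc, Rinv_l by lra; lra.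
  - assert (E : u (S n) = u n) by (rewrite <- Huu in Hmax; nra).
    unfold c; rewrite E; lra. }
destruct (H c Hc Ec) as [M HM].
assert (Hb : forall n, u (S n) - u O <= sum_n (fun k => a k * c k) n).
{ intros n; induction n as [|n IH].
  - rewrite sum_O; apply Hrec.
  - rewrite sum_n_S_R; specialize (Hrec (S n)); lra. }
(* Telescoping gives [u (S n) <= M + u O], while [a n] is at most the running maximum
   [u (S n) * u (S n)]. *)
exists ((M + u O) * (M + u O)); intros n.
apply Rle_trans with (u (S n) * u (S n)).
- rewrite Huu; simpl; apply Rmax_r.
- assert (P := Hu1 (S n)); specialize (Hb n); specialize (HM n); nra.
Qed.

(** * Solving the equation [x - cesaro x = y] *)

(* The summand at [0] is [y 0 / 0], which is harmless when [y 0 = 0]. *)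
Definition harmonic_sum (y : nat -> C) (n : nat) : C :=
  sum_n (fun k => (y k / RtoC (INR k))%C) n.

Lemma INR_S_neq0 n : RtoC (INR (S n)) <> RtoC 0.
Proof. intros E; apply RtoC_inj in E; exact (not_0_INR (S n) (Nat.neq_succ_0 n) E). Qed.

Lemma RtoC_INR_S n : RtoC (INR (S n)) = (RtoC (INR n) + 1)%C.
Proof. rewrite S_INR, RtoC_plus; reflexivity. Qed.

Lemma harmonic_sum_0 (y : nat -> C) : y O = RtoC 0 -> harmonic_sum y O = RtoC 0.
Proof.
intros H; unfold harmonic_sum; rewrite sum_O, H; unfold Cdiv; apply Cmult_0_l.
Qed.

Lemma harmonic_sum_S (y : nat -> C) n :
  harmonic_sum y (S n) = (harmonic_sum y n + y (S n) / RtoC (INR (S n)))%C.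
Proof. apply sum_n_S_C. Qed.

Lemma sum_n_cesaro (x : nat -> C) n :
  sum_n x n = (RtoC (INR (S n)) * cesaro x n)%C :> C.
Proof. unfold cesaro; symmetry; field; apply INR_S_neq0. Qed.

Lemma cesaro_0 (x : nat -> C) : cesaro x O = x O.
Proof. unfold cesaro; rewrite sum_O; simpl; field; apply (INR_S_neq0 0). Qed.

(** With Z the harmonic sum, (n+2) Z_{n+1} - (n+1) Z_n = Z_{n+1} + (n+1) (Z_{n+1} - Z_n) = Z_{n+1} +
    y_{n+1}. *)
Lemma sum_n_plus_harmonic (y : nat -> C) n :
  y O = RtoC 0 ->
  sum_n (fun k => (y k + harmonic_sum y k)%C) n
  = (RtoC (INR (S n)) * harmonic_sum y n)%C :> C.
Proof.
intros Hy; induction n as [|n IH].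
- rewrite sum_O, Hy, harmonic_sum_0 by exact Hy; ring.
- rewrite sum_n_S_C, IH, harmonic_sum_S, (RtoC_INR_S (S n)).
  field; apply INR_S_neq0.
Qed.

Lemma cesaro_plus_harmonic (y : nat -> C) n :
  y O = RtoC 0 ->
  cesaro (fun k => (y k + harmonic_sum y k)%C) n = harmonic_sum y n.
Proof.
intros Hy; unfold cesaro; rewrite sum_n_plus_harmonic by exact Hy.
field; apply INR_S_neq0.
Qed.

(** Writing c for the means of x, x_{n+1} = (n+2) c_{n+1} - (n+1) c_n, so y_{n+1} = (n+1) (c_{n+1} -
    c_n). This is the recursion of the harmonic sum, and both sequences start at 0. *)
Lemma cesaro_eq_harmonic (x y : nat -> C) n :
  x O = RtoC 0 -> (forall k, (x k - cesaro x k)%C = y k) ->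
  cesaro x n = harmonic_sum y n.
Proof.
intros Hx Hy.
induction n as [|n IH].
- rewrite cesaro_0, harmonic_sum_0; [exact Hx|].
  rewrite <- Hy, cesaro_0; ring.
- rewrite harmonic_sum_S, <- IH, <- Hy.
  assert (E := sum_n_S_C x n).
  rewrite !sum_n_cesaro, (RtoC_INR_S (S n)) in E.
  assert (Ex : x (S n) = ((RtoC (INR (S n)) + 1) * cesaro x (S n)
                          - RtoC (INR (S n)) * cesaro x n)%C)
    by (rewrite E; ring).
  rewrite Ex; field; apply INR_S_neq0.
Qed.

Lemma cesaro_minus_const (x : nat -> C) (a : C) n :
  cesaro (fun k => (x k - a)%C) n = (cesaro x n - a)%C.
Proof.
assert (E : sum_n (fun k => (x k - a)%C) n
            = (sum_n x n - RtoC (INR (S n)) * a)%C :> C).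
{ induction n as [|n IH].
  - rewrite !sum_O; simpl; ring.
  - rewrite !sum_n_S_C, IH, (RtoC_INR_S (S n)); ring. }
unfold cesaro; rewrite E; field; apply INR_S_neq0.
Qed.

(** * Closedness of [X1] and approximation by truncations *)

Section Weight.

Context {w : weight}.

Lemma weight_nonneg n : 0 <= w n.
Proof. apply Rlt_le, weight_pos. Qed.

Lemma l1_term_le_norm (x : l1 w) n : w n * Cmod (x n) <= l1_norm x.
Proof.
apply Rle_trans with (sum_n (fun k => w k * Cmod (x k)) n).
- destruct n as [|n]; [rewrite sum_O; apply Rle_refl|].
  rewrite sum_n_S_R.
  assert (Q := sum_n_nonneg _ n (l1_term_ge0 w x)); lra.
- apply sum_n_le_Series; [apply l1_term_ge0 | apply l1_prop].
Qed.

Lemma closed_X1 : closed (@X1 w).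
Proof.
intros x Hx; apply NNPP; intros Hn; apply Hx.
assert (Hpos : 0 < w O * Cmod (x O)).
{ apply Rmult_lt_0_compat; [apply weight_pos | apply Cmod_gt_0; exact Hn]. }
(* A point of [X1] has distance at least [w O * Cmod (x O)] from [x], by the entry at index 0
   alone. *)
exists (mkposreal _ Hpos); intros y Hy Hy0.
change (l1_norm (minus y x) < w O * Cmod (x O)) in Hy.
assert (Q := l1_term_le_norm (minus y x) O).
change (w O * Cmod (y O + - x O)%C <= l1_norm (minus y x)) in Q.
unfold X1 in Hy0; rewrite Hy0, Cplus_0_l, Cmod_opp in Q; lra.
Qed.

Lemma in_l1_eventually_zero (y : nat -> C) N :
  (forall n, (N <= n)%nat -> y n = RtoC 0) -> in_l1 w y.
Proof.
intros Hy; apply (ex_series_incr_n _ N).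
apply (ex_series_ext (fun n => w n * Cmod 0)).
- intros n; rewrite (Hy (N + n)%nat) by lia; rewrite Cmod_0, !Rmult_0_r; reflexivity.
- exact (in_l1_zero w).
Qed.

Definition truncate (y : nat -> C) (N n : nat) : C :=
  if le_dec n N then y n else RtoC 0.

Lemma in_l1_truncate (y : nat -> C) N : in_l1 w (truncate y N).
Proof.
apply (in_l1_eventually_zero _ (S N)); intros n Hn.
unfold truncate; destruct (le_dec n N); [lia|reflexivity].
Qed.

Lemma truncate_close (y : l1 w) (eps : R) :
  0 < eps -> exists N, l1_norm (minus (L1 _ (in_l1_truncate y N)) y) < eps.
Proof.
intros Heps.
destruct (tail_small _ eps (l1_prop y) Heps) as [N HN].
exists N; eapply Rle_lt_trans; [apply Req_le | exact HN].
unfold l1_norm; rewrite (Series_incr_n_aux _ (S N)).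
- apply Series_ext; intros k.
  change (w (S N + k)%nat * Cmod (truncate y N (S N + k) + - y (S N + k)%nat)%C
          = w (S N + k)%nat * Cmod (y (S N + k)%nat)).
  unfold truncate; destruct (le_dec (S N + k) N); [lia|].
  rewrite Cplus_0_l, Cmod_opp; reflexivity.
- intros k Hk.
  change (w k * Cmod (truncate y N k + - y k)%C = 0).
  unfold truncate; destruct (le_dec k N); [|lia].
  rewrite Cplus_opp_r, Cmod_0; ring.
Qed.

(** * Harmonic sums in [l1 w] for summable [w] *)

Hypothesis w_sum : ex_series w.

Lemma in_l1_const (a : C) : in_l1 w (fun _ => a).
Proof.
apply (ex_series_ext (fun n => Cmod a * w n)).
- intros n; apply Rmult_comm.
- exact (ex_series_scal (V := R_NormedModule) (Cmod a) _ w_sum).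
Qed.

Lemma in_l1_harmonic_truncate (y : nat -> C) N :
  in_l1 w (harmonic_sum (truncate y N)).
Proof.
assert (E : forall k, harmonic_sum (truncate y N) (N + k)
                      = harmonic_sum (truncate y N) N).
{ intros k; induction k as [|k IH]; [rewrite Nat.add_0_r; reflexivity|].
  rewrite Nat.add_succ_r, harmonic_sum_S, IH; unfold truncate at 2.
  destruct (le_dec (S (N + k)) N); [lia|].
  unfold Cdiv; rewrite Cmult_0_l, Cplus_0_r; reflexivity. }
apply (ex_series_incr_n _ N).
apply (ex_series_ext
  (fun k => w (N + k)%nat * Cmod (harmonic_sum (truncate y N) N))).
- intros k; rewrite E; reflexivity.
- exact (proj1 (ex_series_incr_n _ N) (in_l1_const _)).
Qed.

Lemma in_l1_harmonic (y : l1 w) (M : R) :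
  y O = RtoC 0 ->
  (forall k, / (INR (S k) * w (S k)) * tail w (S k) <= M) ->
  in_l1 w (harmonic_sum y).
Proof.
intros Hy HM.
set (t := fun k => Cmod (y k / RtoC (INR k))%C).
assert (Ht : forall k, 0 <= t k) by (intros; apply Cmod_ge_0).
assert (Hterm : forall k, t k * tail w k <= M * (w k * Cmod (y k))).
{ intros [|k].
  - unfold t; rewrite Hy; unfold Cdiv; rewrite Cmult_0_l, Cmod_0; lra.
  - assert (Hk : 0 < INR (S k)) by (apply lt_0_INR; lia).
    assert (Hw := weight_pos w (S k)).
    unfold t; rewrite Cmod_div by apply INR_S_neq0.
    rewrite Cmod_R, Rabs_pos_eq by lra.
    replace (Cmod (y (S k)) / INR (S k) * tail w (S k))
      with (/ (INR (S k) * w (S k)) * tail w (S k)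
            * (w (S k) * Cmod (y (S k)))) by (field; lra).
    apply Rmult_le_compat_r; [apply l1_term_ge0 | apply HM]. }
apply (ex_series_le (K := R_AbsRing) (V := R_CompleteNormedModule) _
         (fun n => w n * sum_n t n)).
- intros n.
  change (Rabs (w n * Cmod (harmonic_sum y n)) <= w n * sum_n t n).
  rewrite Rabs_pos_eq by apply l1_term_ge0.
  apply Rmult_le_compat_l; [apply weight_nonneg | apply Cmod_sum_n].
- apply (ex_series_pos_bounded _ (Rabs M * l1_norm y)).
  + intros n; apply Rmult_le_pos; [apply weight_nonneg | apply sum_n_nonneg, Ht].
  + intros n.
    eapply Rle_trans; [apply sum_n_weighted_le; auto using weight_nonneg|].
    (* [Rabs M] spares a discussion of the sign of [M]. *)
    apply Rle_trans with (Rabs M * sum_n (fun k => w k * Cmod (y k)) n).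
    * assert (HM' := Rle_abs M).
      assert (Hterm' : forall k, t k * tail w k <= Rabs M * (w k * Cmod (y k))).
      { intros k; specialize (Hterm k); assert (Q := l1_term_ge0 w y k); nra. }
      clear - Hterm'; induction n as [|n IH].
      -- rewrite !sum_O; apply Hterm'.
      -- rewrite !sum_n_S_R; specialize (Hterm' (S n)); lra.
    * apply Rmult_le_compat_l; [apply Rabs_pos|].
      apply sum_n_le_Series; [apply l1_term_ge0 | apply l1_prop].
Qed.

(** A summable [c >= 0] is turned into the element [r] of [l1 w] with norm series [c], shifted by
    one index. As [r >= 0], its harmonic sum involves no cancellation, and summation by parts bounds
    the sums of the ratios times [c]. *)
Lemma tail_ratio_bounded :
  (forall y : l1 w, y O = RtoC 0 -> in_l1 w (harmonic_sum y)) ->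
  exists M, forall k, / (INR (S k) * w (S k)) * tail w (S k) <= M.
Proof.
intros H; apply bounded_of_l1_multiplier; intros c Hc Ec.
set (r := fun n => match n with O => 0 | S k => c k / w (S k) end).
set (t := fun n => r n / INR n).
assert (Hr : forall n, 0 <= r n).
{ intros [|k]; [apply Rle_refl|].
  apply Rdiv_le_0_compat; [apply Hc | apply weight_pos]. }
assert (Ht : forall n, 0 <= t n).
{ intros [|k]; unfold t; [simpl; lra|].
  apply Rdiv_le_0_compat; [apply Hr | apply lt_0_INR; lia]. }
assert (Ey : in_l1 w (fun n => RtoC (r n))).
{ apply (ex_series_incr_1 (fun n => w n * Cmod (RtoC (r n)))).
  apply (ex_series_ext c); [|exact Ec].
  intros k; rewrite Cmod_R, Rabs_pos_eq by apply Hr.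
  simpl; field; apply Rgt_not_eq, weight_pos. }
(* [r 0] computes to 0, hence [eq_refl]. *)
assert (EZ := H (L1 _ Ey) eq_refl).
assert (Hharm : forall n, Cmod (harmonic_sum (fun k => RtoC (r k)) n) = sum_n t n).
{ intros n; unfold harmonic_sum.
  rewrite (sum_n_ext _ (fun k => RtoC (t k))).
  - rewrite sum_n_RtoC, Cmod_R; apply Rabs_pos_eq, sum_n_nonneg, Ht.
  - intros [|k]; unfold t.
    + simpl; unfold Cdiv, Rdiv; rewrite Cmult_0_l, Rmult_0_l; reflexivity.
    + rewrite RtoC_div; [reflexivity | apply not_0_INR; lia]. }
assert (EZ' : ex_series (fun n => w n * sum_n t n)).
{ apply (ex_series_ext (fun n => w n * Cmod (harmonic_sum (fun k => RtoC (r k)) n)));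
    [|exact EZ].
  intros n; rewrite Hharm; reflexivity. }
exists (Series (fun n => w n * sum_n t n)); intros n.
apply Rle_trans with (sum_n (fun k => t k * tail w k) (S n)).
(* The term at 0 vanishes and the term at [S k] is the ratio of index [k] times [c k], so the sum up
   to [S n] matches the one up to [n]. *)
- apply Req_le; induction n as [|n IH].
  + rewrite sum_n_S_R, !sum_O.
    replace (t O) with 0 by (unfold t; simpl; lra).
    unfold t, r; simpl; field; apply Rgt_not_eq, weight_pos.
  + rewrite sum_n_S_R, IH, (sum_n_S_R _ (S n)); f_equal.
    unfold t, r; field; split; [apply Rgt_not_eq, weight_pos | apply not_0_INR; lia].
- apply sum_n_tail_le_Series; auto using weight_nonneg.
Qed.

(** * The range of [I_minus T] *)

Context (T : l1 w -> l1 w).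
Hypothesis T_cesaro : forall (x : l1 w) n, T x n = cesaro x n.

Lemma I_minus_term (x : l1 w) n : I_minus T x n = (x n - cesaro x n)%C.
Proof. rewrite <- T_cesaro; reflexivity. Qed.

Lemma range_sub_X1 (y : l1 w) : range (I_minus T) y -> X1 y.
Proof.
intros [x [_ <-]]; unfold X1; rewrite I_minus_term, cesaro_0; ring.
Qed.

Lemma range_iff_image_X1 (y : l1 w) :
  range (I_minus T) y <-> image (I_minus T) X1 y.
Proof.
split; [|intros [x [_ E]]; exists x; split; [exact I | exact E]].
intros [x [_ E]].
(* Subtracting the constant [x O] lands in [X1] and leaves the image unchanged. *)
exists (minus x (L1 _ (in_l1_const (x O)))); split.
- change ((x O + - x O)%C = RtoC 0); ring.
- apply l1_ext; intros n; rewrite <- E, !I_minus_term.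
  change ((x n - x O - cesaro (fun k => (x k - x O)%C) n)%C = (x n - cesaro x n)%C).
  rewrite cesaro_minus_const; ring.
Qed.

Lemma image_X1_iff_harmonic (y : l1 w) :
  X1 y -> (image (I_minus T) X1 y <-> in_l1 w (harmonic_sum y)).
Proof.
intros Hy; split.
- intros [x [Hx E]].
  apply (ex_series_ext (fun n => w n * Cmod (T x n))); [|apply l1_prop].
  intros n; rewrite T_cesaro, (cesaro_eq_harmonic x y); auto.
  intros k; rewrite <- I_minus_term, E; reflexivity.
- intros HZ; exists (L1 _ (in_l1_plus w y _ (l1_prop y) HZ)); split.
  + change ((y O + harmonic_sum y O)%C = RtoC 0).
    rewrite harmonic_sum_0, Hy by exact Hy; ring.
  + apply l1_ext; intros n; rewrite I_minus_term; simpl.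
    rewrite cesaro_plus_harmonic by exact Hy; ring.
Qed.

Lemma X1_sub_closed_range (y : l1 w) :
  closed (range (I_minus T)) -> X1 y -> range (I_minus T) y.
Proof.
(* Coquelicot's [closed] puts [y] in the set once no ball around [y] avoids it; a truncation of [y]
   lies in each ball and in the range. *)
intros Hcl Hy; apply Hcl; intros [eps Heps].
destruct (truncate_close y eps (cond_pos eps)) as [N HN].
apply (Heps _ HN).
apply range_iff_image_X1, image_X1_iff_harmonic.
(* The entry at 0 survives truncation at any [N], by computation. *)
- exact Hy.
- exact (in_l1_harmonic_truncate y N).
Qed.

End Weight.

(** * Finiteness of the supremum and the equivalences *)

Lemma Sup_seq_finite_iff (u : nat -> R) :
  Rbar_lt (Sup_seq (fun n => Finite (u n))) p_infty
  <-> exists M, forall n, u n <= M.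
Proof.
assert (H := Sup_seq_correct (fun n => Finite (u n))).
destruct (Sup_seq (fun n => Finite (u n))) as [l| |]; simpl in *; split.
- intros _; exists (l + 1); intros n.
  apply Rlt_le, (H (mkposreal 1 Rlt_0_1)).
- intros _; exact I.
- intros [].
- intros [M HM]; destruct (H M) as [n Hn]; specialize (HM n); lra.
(* In the case [m_infty], every [u n] lies below any real, in particular below 0. *)
- intros _; exists 0; intros n; apply Rlt_le, H.
- intros _; exact I.
Qed.

Theorem proposition4p11 (w : weight) (C1w : l1 w -> l1 w)
  (w_summable : ex_series (fun n => Rabs (w n)))
  (C1w_cesaro : is_cesaro_l1 C1w) :
  let closed_range := closed (range (I_minus C1w)) in
  let range_X1 := forall y : l1 w, range (I_minus C1w) y <-> X1 y in
  let image_X1 := forall y : l1 w, image (I_minus C1w) X1 y <-> X1 y in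
  let U_finite := Rbar_lt (U_ w) p_infty in
  (closed_range <-> range_X1) /\
  (range_X1 <-> image_X1) /\
  (image_X1 <-> U_finite).
Proof.
intros closed_range range_X1 image_X1 U_finite.
assert (Hw : ex_series w) by exact (ex_series_Rabs _ w_summable).
destruct C1w_cesaro as [HT _].
assert (Hri := range_iff_image_X1 Hw C1w HT).
split; [|split].
- split.
  + intros Hcl y; split.
    * apply range_sub_X1, HT.
    * apply X1_sub_closed_range; assumption.
  (* The range agrees with [X1] pointwise, so a ball avoiding [X1] also avoids the range. *)
  + intros H x Hx; apply H, closed_X1; intros [eps Heps]; apply Hx.
    exists eps; intros y Hy Hr; apply (Heps y Hy), H, Hr.
- split; intros H y; rewrite <- (H y); [symmetry|]; apply Hri.
- unfold U_finite, U_; rewrite Sup_seq_finite_iff; split.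
  (* The terms of [U_ w] are convertible to the ratios written with [tail]. *)
  + intros H; apply (tail_ratio_bounded Hw); intros y Hy.
    apply (image_X1_iff_harmonic C1w HT y Hy), H, Hy.
  + intros [M HM] y; split.
    * intros Hy; apply (range_sub_X1 C1w HT), Hri, Hy.
    * intros Hy; apply (image_X1_iff_harmonic C1w HT y Hy).
      exact (in_l1_harmonic Hw y M Hy HM).
Qed.
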